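(* Let $(R,\mathfrak{n})$ be a $3$-dimensional regular local ring with $\mathfrak{n} = (X,Y,Z)$, let $\mathfrak{a} = (X^3, XY, Y^2 - XZ)$ and $A = R/\mathfrak{a}$, with maximal ideal $\mathfrak{m}$. Let $x, y, z$ denote the images of $X, Y, Z$ in $A$. Let $n \geq 1$ be an integer, let $f, g \in A$, and put $a = z^n + xf + yg$, $Q = (a)$, and $I = Q : \mathfrak{m}$. Then the equality $I^2 = QI$ holds true if and only if one of the following conditions is satisfied: (1) $f \notin \mathfrak{m}$. (2) $f \in \mathfrak{m}$ and $n > 1$. Moreover, $I^3 = QI^2$ but $I^2 \neq QI$, if $f \in \mathfrak{m}$ and $n = 1$.
   Context: $A$ is a one-dimensional local ring, and every parameter ideal of $A$ (ideal generated by a system of parameters) can be written in the form $Q = (z^n + xf + yg)$ with $n\geq 1$ and $f,g\in A$. $Q:\mathfrak{m} = \{c\in A \mid c\mathfrak{m}\subseteq Q\}$. *)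

(* Defs.v *)
From mathcomp Require Import all_boot all_order all_algebra.
From mathcomp Require Import boolp classical_sets.

Set Implicit Arguments.
Unset Strict Implicit.
Unset Printing Implicit Defensive.

Import GRing.Theory.

Local Open Scope classical_set_scope.
Local Open Scope ring_scope.

Section Ideals.
Variable R : comNzRingType.
Implicit Types (I J P m G : set R).

(* The [idealr] structure of ring_quotient only covers proper ideals that are
   boolean predicates; here the unit ideal is allowed as well. *)
Definition is_ideal I : Prop :=
  [/\ I 0,
      forall u v, I u -> I v -> I (u + v)
    & forall c u, I u -> I (c * u)].

Definition prime_ideal P : Prop :=
  [/\ is_ideal P,
      ~ P 1
    & forall u v, P (u * v) -> P u \/ P v].

Definition maximal_ideal m : Prop :=
  [/\ is_ideal m,
      m != setT
    & forall J, is_ideal J -> m `<=` J -> J = m \/ J = setT].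

Definition ideal_gen G : set R := smallest is_ideal G.

Definition ideal_mul I J : set R := ideal_gen [set u * v | u in I & v in J].

Definition ideal_exp I (k : nat) : set R := iter k (ideal_mul I) setT.

Definition ideal_colon I J : set R :=
  [set c | forall u, J u -> I (c * u)].

End Ideals.

Definition noetherian (R : comNzRingType) : Prop :=
  forall I : set R, is_ideal I -> exists s : seq R, I = ideal_gen [set` s].

(* A chain P 0 < P 1 < ... < P d of prime ideals; the values of P beyond d are
   irrelevant. *)
Definition prime_chain (R : comNzRingType) (d : nat) (P : nat -> set R) : Prop :=
  (forall i : nat, (i <= d)%N -> prime_ideal (P i)) /\
  (forall i : nat, (i < d)%N -> P i `<` P i.+1).

Definition has_krull_dim (R : comNzRingType) (d : nat) : Prop :=
  (exists P : nat -> set R, prime_chain d P) /\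
  (forall (e : nat) (P : nat -> set R), prime_chain e P -> (e <= d)%N).

(* (R, m) is a local ring; as usual this does not include noetherianity. *)
Definition local_ring (R : comNzRingType) (m : set R) : Prop :=
  maximal_ideal m /\ forall m' : set R, maximal_ideal m' -> m' = m.

(* (R, m) is a regular local ring of dimension d: a noetherian local ring of
   Krull dimension d whose maximal ideal can be generated by d elements. *)
Definition regular_local_ring (R : comNzRingType) (m : set R) (d : nat) : Prop :=
  [/\ noetherian R,
      local_ring m,
      has_krull_dim R d
    & exists s : d.-tuple R, m = ideal_gen [set` s]].

(* Main.v *)
(* The proof works in A with the filtration A > (x, y) > (x) > (x^2) > 0, whose
   successive quotients are the discrete valuation ring A / (x, y) three times,
   then the residue field.  Eliminating along it shows that I lies in
   Q + (x^2, al, be) with al = x z^(n-1) and be = y z^(n-1) + x g.  As x^2 kills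
   m and is not in Q, only al^2, al be and be^2 matter for I^2; they vanish or
   lie in a I, except when n = 1 and f is in m, where I = Q + (x^2, y) and
   y^2 = a x with x not in I.

   The filtration only needs that X, Y, Z is a regular sequence.  This follows
   from Krull's principal ideal theorem: a chain of d primes above the ideal
   (X_1, ..., X_i) can be shifted to a chain of d - 1 primes above
   (X_1, ..., X_(i+1)); as the chain ends at the maximal ideal (X_1, ..., X_d)
   with no prime to spare, each of these ideals is prime. *)

Require Import Defs.
From mathcomp Require Import all_boot all_order all_algebra.
From mathcomp Require Import boolp classical_sets.
From mathcomp Require Import ring.

Set Implicit Arguments.
Unset Strict Implicit.
Unset Printing Implicit Defensive.

Import GRing.Theory.

Local Open Scope classical_set_scope.
Local Open Scope quotient_scope.
Local Open Scope ring_scope.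

(** * Ideals and saturation at a prime *)

Section IdealOperations.
Variable R : comNzRingType.
Implicit Types (I J K L M N P Q : set R) (us : seq R).

Lemma ideal0 I : is_ideal I -> I 0. Proof. by case. Qed.

Lemma idealD I u v : is_ideal I -> I u -> I v -> I (u + v).
Proof. by case=> _ + _; apply. Qed.

Lemma idealZl I c u : is_ideal I -> I u -> I (c * u).
Proof. by case=> _ _; apply. Qed.

Lemma idealZr I c u : is_ideal I -> I u -> I (u * c).
Proof. by rewrite mulrC; apply: idealZl. Qed.

Lemma idealN I u : is_ideal I -> I u -> I (- u).
Proof. by rewrite -mulN1r; apply: idealZl. Qed.

Lemma idealB I u v : is_ideal I -> I u -> I v -> I (u - v).
Proof. by move=> hI Iu Iv; apply: idealD => //; apply: idealN. Qed.

Lemma ideal_properP I : is_ideal I -> I != setT <-> ~ I 1.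
Proof.
move=> hI; split=> [/eqP IT I1 | I1].
  by apply: IT; apply/seteqP; split=> // u _; rewrite -[u]mulr1; apply: idealZl.
by apply/eqP => IT; apply: I1; rewrite IT.
Qed.

Lemma is_ideal0 : is_ideal [set 0 : R].
Proof.
split=> [//|u v -> ->|c u ->]; first by rewrite /= addr0.
by rewrite /= mulr0.
Qed.

Lemma is_idealT : is_ideal [set: R]. Proof. by split. Qed.

Lemma ideal_gen_ideal (G : set R) : is_ideal (ideal_gen G).
Proof.
split=> [I [hI _]|u v hu hv I hGI|c u hu I hGI]; first exact: ideal0.
  by apply: idealD; [case: hGI | apply: hu | apply: hv].
by apply: idealZl; [case: hGI | apply: hu].
Qed.

Lemma sub_ideal_gen (G : set R) : G `<=` ideal_gen G.
Proof. exact: sub_gen_smallest. Qed.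

Lemma ideal_gen_min I (G : set R) :
  is_ideal I -> G `<=` I -> ideal_gen G `<=` I.
Proof. exact: smallest_sub. Qed.

Lemma ideal_gen1E (a : R) : ideal_gen [set a] = [set a * c | c in [set: R]].
Proof.
apply/seteqP; split=> [|_ [c _ <-]]; last first.
  by apply: (idealZr _ (ideal_gen_ideal _)); apply: sub_ideal_gen.
apply: ideal_gen_min => [|_ ->]; last by exists 1; rewrite ?mulr1.
split; first by exists 0; rewrite ?mulr0.
  by move=> _ _ [c _ <-] [d _ <-]; exists (c + d); rewrite ?mulrDr.
by move=> e _ [c _ <-]; exists (e * c) => //; rewrite mulrCA.
Qed.

Lemma ideal_mulM I J u v : I u -> J v -> ideal_mul I J (u * v).
Proof. by move=> Iu Jv; apply: sub_ideal_gen; exists u => //; exists v. Qed.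

Lemma ideal_mul_min I J K :
  is_ideal K -> (forall u v, I u -> J v -> K (u * v)) -> ideal_mul I J `<=` K.
Proof. by move=> hK h; apply: ideal_gen_min => // _ [u Iu [v Jv <-]];
  apply: h. Qed.

Lemma ideal_mul_ideal I J : is_ideal (ideal_mul I J).
Proof. exact: ideal_gen_ideal. Qed.

Lemma ideal_mulT I : is_ideal I -> ideal_mul I setT = I.
Proof.
move=> hI; apply/seteqP; split=> [|u Iu].
  by apply: ideal_mul_min => // u v Iu _; apply: idealZr.
by rewrite -[u]mulr1; apply: ideal_mulM.
Qed.

Lemma ideal_mul1E (a : R) J : is_ideal J ->
  ideal_mul (ideal_gen [set a]) J = [set a * c | c in J].
Proof.
move=> hJ; apply/seteqP; split=> [|_ [c Jc <-]]; last first.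
  by apply: ideal_mulM => //; apply: sub_ideal_gen.
apply: ideal_mul_min => [|u v]; last first.
  by rewrite ideal_gen1E => -[c _ <-] Jv; exists (c * v); rewrite ?mulrA //;
    apply: idealZl.
split; first by exists 0; rewrite ?mulr0 //; apply: ideal0.
  by move=> _ _ [c Jc <-] [d Jd <-]; exists (c + d); rewrite ?mulrDr //;
    apply: idealD.
by move=> e _ [c Jc <-]; exists (e * c); [apply: idealZl | rewrite mulrCA].
Qed.

Lemma ideal_exp_ideal I k : is_ideal (ideal_exp I k).
Proof. by case: k => [|k]; [apply: is_idealT | apply: ideal_mul_ideal]. Qed.

Lemma ideal_expS_sub I k : ideal_exp I k.+1 `<=` ideal_exp I k.
Proof.
by apply: ideal_mul_min => [|u v _ Iv]; [|apply: idealZl => //];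
  apply: ideal_exp_ideal.
Qed.

Lemma ideal_colon_ideal I J : is_ideal I -> is_ideal (ideal_colon I J).
Proof.
move=> hI; split=> [u _|c d hc hd u Ju|c d hd u Ju].
- by rewrite mul0r; apply: ideal0.
- by rewrite mulrDl; apply: idealD => //; [apply: hc | apply: hd].
- by rewrite -mulrA; apply: idealZl => //; apply: hd.
Qed.

Definition ideal_add I J : set R := [set u + v | u in I & v in J].

Lemma ideal_add_ideal I J : is_ideal I -> is_ideal J
  -> is_ideal (ideal_add I J).
Proof.
move=> hI hJ; split.
- by exists 0; [apply: ideal0|exists 0; [apply: ideal0|rewrite addr0]].
- move=> _ _ [u Iu [v Jv <-]] [u' Iu' [v' Jv' <-]].
  by exists (u + u'); [apply: idealD|exists (v + v');
    [apply: idealD|rewrite addrACA]].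
- move=> c _ [u Iu [v Jv <-]].
  by exists (c * u); [apply: idealZl|exists (c * v);
    [apply: idealZl|rewrite mulrDr]].
Qed.

Lemma ideal_addl I J : is_ideal J -> I `<=` ideal_add I J.
Proof. by move=> hJ u Iu; exists u => //; exists 0; rewrite ?addr0 //;
  apply: ideal0. Qed.

Lemma ideal_addr I J : is_ideal I -> J `<=` ideal_add I J.
Proof. by move=> hI u Iu; exists 0; [apply: ideal0|exists u => //;
  rewrite add0r]. Qed.

Lemma ideal_add_min I J K : is_ideal K -> I `<=` K -> J `<=` K ->
  ideal_add I J `<=` K.
Proof. by move=> hK IK JK _ [u /IK ? [v /JK ? <-]]; apply: idealD. Qed.

Definition adjoin I (x : R) : set R := ideal_add I [set t * x | t in [set: R]].

Lemma principal_ideal x : is_ideal [set t * x | t in [set: R]].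
Proof.
split; first by exists 0; rewrite ?mul0r.
  by move=> _ _ [c _ <-] [d _ <-]; exists (c + d); rewrite ?mulrDl.
by move=> e _ [c _ <-]; exists (e * c); rewrite ?mulrA.
Qed.

Lemma adjoin_ideal I x : is_ideal I -> is_ideal (adjoin I x).
Proof. by move=> hI; apply: ideal_add_ideal => //; apply: principal_ideal. Qed.

Lemma sub_adjoin I x : I `<=` adjoin I x.
Proof. exact/ideal_addl/principal_ideal. Qed.

Lemma mem_adjoin I x : is_ideal I -> adjoin I x x.
Proof. by move=> hI; apply: ideal_addr => //; exists 1; rewrite ?mul1r. Qed.

Lemma adjoin_min I J x : is_ideal J -> I `<=` J -> J x -> adjoin I x `<=` J.
Proof.
by move=> hJ IJ Jx; apply: ideal_add_min => // _ [t _ <-]; apply: idealZl.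
Qed.

Lemma foldl_adjoin_ideal I us : is_ideal I -> is_ideal (foldl adjoin I us).
Proof. by elim: us I => //= u us IH I hI; apply: IH; apply: adjoin_ideal. Qed.

Lemma sub_foldl_adjoin I us : I `<=` foldl adjoin I us.
Proof.
elim: us I => [|u us IH] I; first exact.
by apply: (subset_trans _ (IH _)); apply: sub_adjoin.
Qed.

(** Membership in a finitely generated ideal can then be destructed into explicit coefficients, and
    generators can be peeled off one at a time. *)
Lemma ideal_gen_seqE us : ideal_gen [set` us] = foldl adjoin [set 0] us.
Proof.
have mem I : is_ideal I -> [set` us] `<=` foldl adjoin I us.
  elim: us I => //= u us IH I hI v /=; rewrite inE => /orP[/eqP ->|].
    by apply: sub_foldl_adjoin; apply: mem_adjoin.
  by apply: IH; apply: adjoin_ideal.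
have min I J : is_ideal J -> I `<=` J -> [set` us] `<=` J ->
    foldl adjoin I us `<=` J.
  elim: us I {mem} => [|u us IH] I hJ IJ usJ; first exact: IJ.
  apply: IH => //.
    by apply: adjoin_min => //; apply: usJ; rewrite /= inE eqxx.
  by move=> v vus; apply: usJ; rewrite /= inE; apply/orP; right.
have h0 := is_ideal0; apply/seteqP; split.
  by apply: ideal_gen_min; [apply: foldl_adjoin_ideal | apply: mem].
apply: (min _ _ (ideal_gen_ideal _) _ (@sub_ideal_gen _)) => _ ->.
exact: (ideal0 (ideal_gen_ideal _)).
Qed.

(** For an ideal [J] this is the product of [J] with the ideal generated by [us], in a form that
    exposes the coefficient of the first generator. *)
Fixpoint combinations J us : set R :=
  if us is u :: us' then
    ideal_add [set t * u | t in J] (combinations J us')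
  else [set 0].

Lemma combinations_ideal J us : is_ideal J -> is_ideal (combinations J us).
Proof.
move=> hJ; elim: us => [|u us IH]; first exact: is_ideal0.
apply: ideal_add_ideal => //; split; first by exists 0; rewrite ?mul0r //;
  apply: ideal0.
  by move=> _ _ [c Jc <-] [d Jd <-]; exists (c + d); rewrite ?mulrDl //;
    apply: idealD.
by move=> e _ [c Jc <-]; exists (e * c); rewrite ?mulrA //; apply: idealZl.
Qed.

Lemma mem_combinationsT us : [set` us] `<=` combinations setT us.
Proof.
elim: us => //= u us IH v /=; rewrite inE => /orP[/eqP ->|vus].
  by exists u; [exists 1; rewrite ?mul1r | exists 0; rewrite ?addr0 //;
     exact: (ideal0 (combinations_ideal _ is_idealT))].
exists 0; first by exists 0; rewrite ?mul0r.
by exists v; [apply: IH | rewrite add0r].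
Qed.

Lemma combinationsM J us x t : is_ideal J -> J x -> combinations setT us t ->
  combinations J us (x * t).
Proof.
move=> hJ Jx; elim: us t => [_ ->|u us IH _ [_ [c _ <-] [v /IH hv <-]]] /=.
  by rewrite mulr0.
exists (x * c * u); first by exists (x * c) => //; apply: idealZr.
by exists (x * v) => //; rewrite mulrDr mulrA.
Qed.

Lemma combinations_sub J K us : is_ideal K -> [set` us] `<=` K ->
  combinations J us `<=` K.
Proof.
move=> hK; elim: us => [_ _ ->|u us IH usK]; first exact: ideal0.
apply: ideal_add_min => // [_ [t _ <-]|].
  by apply: idealZl => //; apply: usK; rewrite /= inE eqxx.
by apply: IH => v vus; apply: usK; rewrite /= inE; apply/orP; right.
Qed.

(* The contraction to R of the localization of L at N. *)
Definition saturation N L : set R := [set u | exists2 s, ~ N s & L (s * u)].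

Lemma primeM N s t : prime_ideal N -> ~ N s -> ~ N t -> ~ N (s * t).
Proof. by case=> _ _ h Ns Nt /h []. Qed.

Lemma saturation_ideal N L : prime_ideal N -> is_ideal L ->
  is_ideal (saturation N L).
Proof.
move=> hN hL; have [_ N1 _] := hN; split.
- by exists 1 => //; rewrite mulr0; apply: ideal0.
- move=> u v [s Ns Ls] [t Nt Lt]; exists (s * t); first exact: primeM.
  rewrite mulrDr; apply: idealD => //.
    by rewrite mulrAC; apply: idealZr.
  by rewrite -mulrA; apply: idealZl.
- by move=> c u [s Ns Ls]; exists s => //; rewrite mulrCA; apply: idealZl.
Qed.

Lemma sub_saturation N L : prime_ideal N -> L `<=` saturation N L.
Proof. by case=> _ N1 _ u Lu; exists 1; rewrite ?mul1r. Qed.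

Lemma saturation_mono N L L' : L `<=` L' -> saturation N L `<=` saturation N L'.
Proof. by move=> LL' u [s Ns /LL' Ls]; exists s. Qed.

Lemma saturationP N L s u : prime_ideal N -> ~ N s -> saturation N L (s * u) ->
  saturation N L u.
Proof.
by move=> hN Ns [t Nt Lt]; exists (t * s); [apply: primeM | rewrite -mulrA].
Qed.

(* The last generator is eliminated: [s * u = l + j * u + v] with [j] in [N]
   gives [(s - j) * u = l + v], and [s - j] is still outside [N]. *)
Lemma nakayama_saturation N J L us :
  prime_ideal N -> is_ideal J -> is_ideal L -> J `<=` N ->
  [set` us] `<=` saturation N (ideal_add L (combinations J us)) ->
  [set` us] `<=` saturation N L.
Proof.
move=> hN hJ hL JN; elim: us => //= u us IH hus.
have hC := combinations_ideal us hJ.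
have [|s Ns [l Ll [_ [_ [j Jj <-] [v Cv <-]] E]]] := hus u; first
  by rewrite /= inE eqxx.
have [iN _ _] := hN.
have Nsj : ~ N (s - j).
  by move=> Nsj; apply: Ns; rewrite -(subrK j s); apply: idealD => //;
    apply: JN.
have Esj : (s - j) * u = l + v by rewrite mulrBl -E; ring.
have usL : [set` us] `<=` saturation N L.
  apply: IH => w wus.
  have [|s' Ns' [l' Ll' [_ [_ [j' Jj' <-] [v' Cv' <-]] E']]] := hus w.
    by rewrite /= inE; apply/orP; right.
  (* Multiplying the relation for [w] by [s - j] turns its [u] term into an element of [L] plus a
     combination of [us]. *)
  exists ((s - j) * s'); first exact: primeM.
  exists ((s - j) * l' + j' * l); first by apply: idealD => //; apply: idealZl.
  exists (j' * v + (s - j) * v'); first by apply: idealD => //; apply: idealZl.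
  have -> : (s - j) * s' * w = (s - j) * (s' * w) by rewrite mulrA.
  rewrite -E'.
  have -> : (s - j) * (l' + (j' * u + v')) = (s - j) * l' + j' * ((s - j) * u)
    + (s - j) * v' by ring.
  by rewrite Esj; ring.
move=> w /=; rewrite inE => /orP[/eqP ->|]; last exact: usL.
apply: (saturationP hN Nsj); rewrite Esj.
apply: idealD; [exact: saturation_ideal | exact: sub_saturation |].
by apply: combinations_sub Cv => //; apply: saturation_ideal.
Qed.

End IdealOperations.

(** * Noetherian rings, Nakayama's lemma and Krull's principal ideal theorem *)

Section Noetherian.
Variables (R : comNzRingType) (hR : noetherian R).
Implicit Types (I J K L M N P Q : set R).

(** A counterexample would start, by choice, a strictly increasing chain of ideals; their union is
    finitely generated, hence contained in one of them. *)
Lemma noetherian_ind (Phi : set R -> Prop) :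
  (forall I, is_ideal I -> (forall J, is_ideal J -> I `<` J -> Phi J)
    -> Phi I) ->
  forall I, is_ideal I -> Phi I.
Proof.
move=> step I0 hI0; apply: contrapT => nPhi0.
pose T := {I : set R | is_ideal I /\ ~ Phi I}.
have /choice[next hnext] (p : T) : exists q : T, sval p `<` sval q.
  case: p => I [hI nPhi] /=; apply: contrapT => hq; apply: nPhi.
  apply: step => // J hJ IJ; apply: contrapT => nPhiJ; apply: hq.
  by exists (exist _ J (conj hJ nPhiJ)).
pose F k := sval (iter k next (exist _ I0 (conj hI0 nPhi0))).
have hF k : is_ideal (F k) by rewrite /F; case: (iter _ _ _) => ? [].
have FS k : F k `<` F k.+1 by apply: hnext.
have Fle k l : (k <= l)%N -> F k `<=` F l.
  elim: l => [|l IH]; first by rewrite leqn0 => /eqP ->.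
  rewrite leq_eqVlt => /orP[/eqP -> //|]; rewrite ltnS => /IH kl.
  by apply: subset_trans kl _; case: (FS l).
pose U := [set u | exists k, F k u].
have hU : is_ideal U.
  split; first by by exists 0%N; apply: (ideal0 (hF _)).
    move=> u v [k Fu] [l Fv]; exists (maxn k l); apply: (idealD (hF _)).
      exact: Fle (leq_maxl _ _) _ Fu.
    exact: Fle (leq_maxr _ _) _ Fv.
  by move=> c u [k Fu]; exists k; apply: (idealZl _ (hF _)).
have [s EU] := hR hU.
have [k sk] : exists k, [set` s] `<=` F k.
  have : [set` s] `<=` U by rewrite EU; apply: sub_ideal_gen.
  elim: s {EU} => [_|u s IH us]; first by exists 0%N.
  have [k Fu] : U u by apply: us; rewrite /= inE eqxx.
  have [|l sl] := IH; first by move=> v vs; apply: us; rewrite /= inE;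
    apply/orP; right.
  exists (maxn k l) => v /=; rewrite inE => /orP[/eqP ->|/sl].
    exact: Fle (leq_maxl _ _) _ Fu.
  exact: Fle (leq_maxr _ _) _.
have [_ [] u Fu] := FS k.
have : U u by exists k.+1.
by rewrite EU => /(ideal_gen_min (hF k) sk).
Qed.

Lemma noetherian_max (C : set R -> Prop) I :
  (forall J, C J -> is_ideal J) -> C I ->
  exists2 J, C J & I `<=` J /\ forall K, C K -> J `<=` K -> K = J.
Proof.
move=> hC CI; have hI := hC _ CI; move: I hI CI.
apply: (@noetherian_ind (fun I => C I -> exists2 J, C J & I `<=` J /\
  forall K, C K -> J `<=` K -> K = J)) => I hI IH CI.
have [[K CK IK]|nK] := pselect (exists2 K, C K & I `<` K).
  have [J CJ [KJ maxJ]] := IH _ (hC _ CK) IK CK.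
  by exists J => //; split=> //; apply: (subset_trans _ KJ); case: IK.
exists I => //; split=> // K CK IK; apply: contrapT => KI; apply: nK.
exists K => //; split=> // KI'; apply: KI.
by apply/seteqP.
Qed.

Lemma noetherian_combinations I : is_ideal I ->
  exists us, [set` us] `<=` I /\ I `<=` combinations setT us.
Proof.
move=> hI; have [us EI] := hR hI; exists us; split.
  by rewrite EI; apply: sub_ideal_gen.
rewrite EI; apply: ideal_gen_min; last exact: mem_combinationsT.
exact/combinations_ideal/is_idealT.
Qed.

(** Nakayama's lemma in the localization at [N], expressed through contractions to [R]. *)
Lemma nakayama N J K L : prime_ideal N -> is_ideal J -> is_ideal K
  -> is_ideal L ->
  J `<=` N -> K `<=` saturation N (ideal_add L (ideal_mul J K)) ->
  K `<=` saturation N L.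
Proof.
move=> hN hJ hK hL JN h; have [us [usK Kus]] := noetherian_combinations hK.
have hs := saturation_ideal hN hL.
suff usL : [set` us] `<=` saturation N L.
  by apply: subset_trans Kus _; apply: combinations_sub.
apply: (nakayama_saturation hN hJ hL JN); apply: subset_trans usK _.
apply: subset_trans h _; apply: saturation_mono.
have hC := combinations_ideal us hJ.
apply: ideal_add_min; [exact: ideal_add_ideal | exact: ideal_addl |].
apply: ideal_mul_min; first exact: ideal_add_ideal.
by move=> u v Ju Kv; apply: ideal_addr => //; apply: combinationsM => //;
  apply: Kus.
Qed.

(* Descending chains stabilize in the localization at M modulo any ideal
   containing P and x, because M is minimal over P + (x): above such an ideal I
   there is a submodule of R / I locally isomorphic to R / M. *)
Lemma minimal_prime_dcc M P x (K : nat -> set R) :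
  prime_ideal M -> M x -> P `<=` M ->
  (forall P', prime_ideal P' -> P `<=` P' -> P' x -> P' `<=` M -> M `<=` P') ->
  (forall k, is_ideal (K k)) -> (forall k, K k.+1 `<=` K k) ->
  forall I, is_ideal I -> P `<=` I -> I x ->
  exists k, forall l, (k <= l)%N -> K k `<=` saturation M (ideal_add (K l) I).
Proof.
move=> hM Mx PM minM hK KS.
have Kle k l : (k <= l)%N -> K l `<=` K k.
  elim: l => [|l IH]; first by rewrite leqn0 => /eqP ->.
  rewrite leq_eqVlt => /orP[/eqP -> //|]; rewrite ltnS => /IH kl.
  exact: subset_trans (KS l) kl.
have [iM M1 Mprime] := hM.
apply: noetherian_ind => I hI IH PI Ix.
have [[s Is Ms]|IM] := pselect (exists2 s, I s & ~ M s).
  exists 0%N => l _ u _; exists s => //; rewrite mulrC.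
  by apply: ideal_addr => //; apply: (idealZl _ hI).
have {}IM : I `<=` M by move=> s Is; apply: contrapT => Ms; apply: IM; exists s.
(* [ann g] annihilates the class of [g] in the localization of [R / I] at [M]. A maximal one among
   nonzero classes is prime, and the minimality of [M] makes it contain [M]. *)
pose ann g : set R := [set t | saturation M I (t * g)].
have hs := saturation_ideal hM hI.
have hann g : is_ideal (ann g).
  split; first by rewrite /ann /= mul0r; apply: ideal0.
    by move=> u v hu hv; rewrite /ann /= mulrDl; apply: idealD.
  by move=> c u hu; rewrite /ann /= -mulrA; apply: idealZl.
pose C (J : set R) := exists2 g, ~ saturation M I g & J = ann g.
have nsat1 : ~ saturation M I 1 by move=> [s Ms]; rewrite mulr1 => /IM.
have [_ [g ng ->] [_ maxg]] : exists2 J, C J & ann 1 `<=` J /\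
    forall K, C K -> J `<=` K -> K = J.
  apply: noetherian_max; last by exists 1.
  by move=> J [g _ ->].
have satS : I `<=` saturation M I by apply: sub_saturation.
have primeg : prime_ideal (ann g).
  split=> //; first by rewrite /ann /= mul1r.
  move=> u v uv; have [|nu] := pselect (ann g u); [by left | right].
  have <- : ann (u * g) = ann g.
    apply: maxg; first by exists (u * g).
    by move=> t; rewrite /ann /= mulrCA => /(idealZl u hs).
  by rewrite /ann /= mulrA (mulrC v).
have Mg t : M t -> saturation M I (t * g).
  apply: (minM (ann g)) => // [u Pu||u [s Ms Iu]].
  - by apply/satS/(idealZr _ hI)/PI.
  - exact/satS/(idealZr _ hI).
  - by apply: contrapT => Mu; apply/ng/(saturationP hM Mu); exists s.
have [k1 stab1] : exists k, forall l, (k <= l)%N ->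
    K k `<=` saturation M (ideal_add (K l) (adjoin I g)).
  apply: IH; first exact: adjoin_ideal.
  - split; first exact: sub_adjoin.
    by move=> /(_ _ (mem_adjoin g hI)) /satS.
  - by apply: subset_trans PI _; apply: sub_adjoin.
  - exact: sub_adjoin.
have hKI l := ideal_add_ideal (hK l) hI.
(* If [g] locally leaves [K l0 + I], the coefficients [t] of [g] are forced into [M], so [t * g]
   falls into [I]. Otherwise adjoining [g] does not enlarge any [K l + I] locally. *)
have [[l0 nl0]|hall] := pselect (exists l,
  ~ saturation M (ideal_add (K l) I) g).
  exists (maxn k1 l0) => l; rewrite geq_max => /andP[k1l l0l] u Ku.
  have /(stab1 l k1l)[s Ms [v Kv [_ [i Ii [_ [t _ <-] <-]] E]]] : K k1 u.
    exact: Kle (leq_maxl _ _) _ Ku.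
  have Mt : M t.
    apply: contrapT => Mt; apply: nl0; exists t => //.
    have -> : t * g = (s * u - v) - i by rewrite -E; ring.
    apply: (idealB (hKI _)); last exact: ideal_addr.
    apply: ideal_addl => //; apply: (idealB (hK _)); last exact: Kle l0l _ Kv.
    by apply: (idealZl _ (hK _)); apply: Kle (leq_maxr _ _) _ Ku.
  have [s' Ms' Itg] := Mg t Mt.
  exists (s' * s); first exact: primeM.
  rewrite -mulrA -E !mulrDr; exists (s' * v); first exact: (idealZl _ (hK _)).
  by exists (s' * i + s' * (t * g)) => //; apply: (idealD hI) => //;
    apply: (idealZl _ hI).
exists k1 => l k1l u Ku.
have gl : saturation M (ideal_add (K l) I) g by apply: contrapT => h;
  apply: hall; exists l.
have [s Ms hsu] := stab1 l k1l u Ku.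
have hsat := saturation_ideal hM (hKI l).
apply: (saturationP hM Ms); move: (s * u) hsu.
apply: ideal_add_min => //.
  by apply: (subset_trans _ (sub_saturation hM)); apply: ideal_addl.
apply: adjoin_min => //.
by apply: (subset_trans _ (sub_saturation hM)); apply: ideal_addr.
Qed.

(* Krull's principal ideal theorem: if M were minimal over P + (x), the symbolic
   powers [S k] of Q modulo P would stabilize, and Nakayama's lemma at M, then at
   Q, would give Q = P. *)
Lemma krull_between P Q M x :
  prime_ideal P -> prime_ideal Q -> prime_ideal M ->
  P `<` Q -> Q `<` M -> M x ->
  exists P', [/\ prime_ideal P', P `<` P', P' `<` M & P' x].
Proof.
move=> hP hQ hM PQ QM Mx; apply: contrapT => nex.
have [Qx|nQx] := pselect (Q x); first by apply: nex; exists Q.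
have [PsQ nQP] := PQ; have [QsM nMQ] := QM.
have PM : P `<=` M by apply: (subset_trans _ QsM).
have minM P' : prime_ideal P' -> P `<=` P' -> P' x -> P' `<=` M -> M `<=` P'.
  move=> hP' PP' P'x P'M; apply: contrapT => nMP'; apply: nex; exists P'.
  by split=> //; split=> // P'P; apply: nQx; apply/PsQ/P'P.
have [iP P1 Pprime] := hP; have [iQ Q1 Qprime] := hQ.
pose S k := saturation Q (ideal_add (ideal_exp Q k) P).
have hQP k : is_ideal (ideal_add (ideal_exp Q k) P).
  exact: ideal_add_ideal (ideal_exp_ideal _ _) iP.
have hS k : is_ideal (S k) by apply: saturation_ideal.
have SS k : S k.+1 `<=` S k.
  apply: saturation_mono; apply: ideal_add_min => //;
    last exact/ideal_addr/ideal_exp_ideal.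
  by apply: (subset_trans (@ideal_expS_sub _ _ _)); apply: ideal_addl.
have [k stab] := minimal_prime_dcc hM Mx PM minM hS SS (adjoin_ideal x iP)
  (@sub_adjoin _ P x) (mem_adjoin x iP).
have ix := principal_ideal x.
(* [S k] is saturated at [Q] and [x] is not in [Q], so the coefficient [t] of [x] is itself in
   [S k]. *)
have {}stab : S k `<=`
    saturation M (ideal_add (S k.+1) (ideal_mul [set t * x | t in setT] (S k))).
  move=> u Su; have := stab k.+1 (leqnSn k) u Su.
  move=> [s Ms [v Sv [_ [p Pp [_ [t _ <-] <-]] E]]].
  have PS l : P `<=` S l.
    by apply: (subset_trans _ (sub_saturation hQ));
      apply/ideal_addr/ideal_exp_ideal.
  exists s => //; rewrite -E addrA.
  exists (v + p); first by apply: (idealD (hS _)) => //; apply: PS.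
  exists (t * x) => //; rewrite mulrC; apply: ideal_mulM; first by exists 1;
    rewrite ?mul1r.
  apply: (saturationP hQ nQx).
  have -> : x * t = (s * u - v) - p by rewrite -E; ring.
  apply: (idealB (hS _)); last exact: PS.
  by apply: (idealB (hS _)); [apply: (idealZl _ (hS _)) | apply: SS].
(* Nakayama at [M], which contains [x]; factors outside [M] are outside [Q], so [S k.+1] absorbs
   them. *)
have {}stab : S k `<=` S k.+1.
  have iM : is_ideal M by case: hM.
  have /nakayama h : [set t * x | t in [set: R]] `<=` M.
    by move=> _ [t _ <-]; apply: idealZl.
  move=> u /(h _ _ hM ix (hS k) (hS k.+1) stab)[s Ms].
  by apply: saturationP => // Qs; apply/Ms/QsM.
(* Nakayama at [Q]: locally, [Q^k] lies in [P + Q Q^k]. *)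
have QkP : ideal_exp Q k `<=` saturation Q P.
  apply: (nakayama hQ iQ (ideal_exp_ideal Q k) iP (fun _ => id)).
  move=> u Qu; have /stab[s Qs [v Qv [p Pp E]]] : S k u.
    by apply/(sub_saturation hQ)/ideal_addl.
  by exists s => //; exists p => //; exists v; rewrite // addrC.
have {}QkP : ideal_exp Q k `<=` P.
  by move=> u /QkP[s Qs /Pprime[/PsQ|]].
(* An element of [Q] outside the prime [P] lowers the exponent, until [Q^0 = R] would lie in [P]. *)
apply: nQP; elim: k {stab} QkP => [h|k IH h]; first by case: P1; apply: h.
move=> q Qq; have [//|nPq] := pselect (P q).
apply: (IH _ _ Qq) => u Qu.
by have [] := Pprime q u (h _ (ideal_mulM Qq Qu)).
Qed.

End Noetherian.

(** * Chains of primes in local rings *)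

Section RegularSequence.
Variables (R : comNzRingType) (hR : noetherian R).
Implicit Types (I J K : set R) (P Q : nat -> set R) (xs : seq R).

(** [krull_between] at the top three primes replaces the middle one by a prime containing [x]. Below
    the top this leaves a shorter chain whose last prime contains [x], and induction applies to
    it. *)
Lemma chain_shift e P x : prime_chain e.+1 P -> P e.+1 x ->
  exists Q, [/\ prime_chain e Q, P 0%N `<=` Q 0%N, Q 0%N x & Q e = P e.+1].
Proof.
elim: e P => [|e IH] P [hP ltP] Px.
  exists (fun=> P 1%N); split=> //; last by case: (ltP 0%N).
  by split=> // i _; apply: hP.
have [P' [hP' PP' P'P P'x]] := krull_between hR (hP e (leqW (leqnSn e)))
  (hP e.+1 (leqnSn _)) (hP e.+2 (leqnn _)) (ltP e (leqnSn _)) (ltP e.+1 (leqnn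
    _)) Px.
pose P1 i := if (i <= e)%N then P i else P'.
have [||Q [[hQ ltQ] P0Q Q0x Qe]] := IH P1; last 1 first.
- exists (fun i => if (i <= e)%N then Q i else P e.+2).
  rewrite leq0n ltnn; split=> //; split=> i.
    by case: (leqP i e) => [/hQ //|_ _]; apply: hP.
  rewrite ltnS => /[dup] + ->; rewrite leq_eqVlt => /orP[/eqP -> |ie].
    by rewrite ltnn Qe /P1 ltnn.
  by rewrite ie; apply: ltQ.
- split=> i.
    by rewrite /P1; case: (leqP i e) => // /leqW/leqW /hP.
  rewrite ltnS /P1 => /[dup] + ->; rewrite leq_eqVlt => /orP[/eqP -> |ie].
    by rewrite ltnn.
  by rewrite ie; apply/ltP/leqW/leqW.
- by rewrite /P1 ltnn.
Qed.

Variables (nn : set R) (hloc : local_ring nn).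

Lemma proper_sub_local I : is_ideal I -> ~ I 1 -> I `<=` nn.
Proof.
move=> hI I1.
have [J [hJ J1] [IJ maxJ]] : exists2 J, is_ideal J /\ ~ J 1 &
    I `<=` J /\ forall K, is_ideal K /\ ~ K 1 -> J `<=` K -> K = J.
  by apply: (noetherian_max hR) => // J [].
suff <- : J = nn by [].
apply: hloc.2; split=> //; first exact/ideal_properP.
move=> K hK JK; have [K1|nK1] := pselect (K 1); [right | left; exact: maxJ].
by apply: contrapT => /eqP/(ideal_properP hK).
Qed.

Lemma local_ideal : is_ideal nn. Proof. by case: hloc => -[]. Qed.

Lemma local_proper : ~ nn 1.
Proof. by case: hloc => -[hn /(ideal_properP hn)]. Qed.

Lemma local_unit s : ~ nn s -> exists t, t * s = 1.
Proof.
move=> ns; have [[t _ <-]|n1] := pselect ([set t * s | t in [set: R]] 1).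
  by exists t.
case: ns; apply: (proper_sub_local (principal_ideal s) n1).
by exists 1; rewrite ?mul1r.
Qed.

Lemma local_prime : prime_ideal nn.
Proof.
split; [exact: local_ideal | exact: local_proper | move=> u v nuv].
have [nu|/local_unit[t tu]] := pselect (nn u); [by left | right].
by rewrite -[v]mul1r -tu -mulrA; apply/(idealZl _ local_ideal).
Qed.

(** Elements outside [nn] are units, so at [nn] the localized Nakayama lemma becomes the usual
    one. *)
Lemma saturation_local I : is_ideal I -> saturation nn I `<=` I.
Proof.
move=> hI u [s /local_unit[t ts] Isu].
by rewrite -[u]mul1r -ts -mulrA; apply/(idealZl _ hI).
Qed.

(** A strong form of regular sequence modulo [J]: each element is nonzero in a quotient that is a
    domain, hence a nonzerodivisor there. *)
Fixpoint prime_sequence J xs : Prop :=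
  if xs is x :: xs' then
    [/\ prime_ideal J, ~ J x & prime_sequence (adjoin J x) xs']
  else True.

(** Induction on [xs]: a shifted chain lies above [J + (x)], whose primality and equality with the
    new bottom prime come from the induction or from the nil case; Nakayama then brings [P 0] down
    to [J]. *)
Lemma prime_sequence_of_chain xs J e P :
  is_ideal J -> nn = foldl (@adjoin R) J xs -> prime_chain e P
    -> J `<=` P 0%N ->
  (size xs <= e)%N -> [/\ e = size xs, P 0%N = J & prime_sequence J xs].
Proof.
have subn i e' Q : prime_chain e' Q -> (i <= e')%N -> Q i `<=` nn.
  by move=> [hQ _] /hQ[iQ Q1 _]; apply: proper_sub_local.
have inn := local_ideal.
elim: xs J e P => [|x xs IH] J e P iJ /= nE cP JP.
  move=> _; have P0 : P 0%N = J.
    by apply/seteqP; split=> //; rewrite -nE; apply: subn cP _.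
  split=> //; case: e cP => // e cP.
  have [_ []] := cP.2 0%N isT; rewrite P0 -nE; exact: subn cP _.
case: e cP => // e cP; rewrite ltnS => lee.
have iJx := adjoin_ideal x iJ.
have nnx : nn x by rewrite nE; apply/sub_foldl_adjoin/mem_adjoin.
(* The top prime becomes [nn], so that it contains [x] as [chain_shift] requires. *)
pose P' i := if (i <= e)%N then P i else nn.
have cP' : prime_chain e.+1 P'.
  have [hP ltP] := cP; split=> i.
    rewrite /P'; case: (leqP i e) => [/leqW/hP //|_ _]; exact: local_prime.
  rewrite ltnS /P' => /[dup] + ->; rewrite leq_eqVlt => /orP[/eqP -> |ie].
    rewrite ltnn; have [Pe nPe] := ltP e (leqnn _).
    have Pn := subn _ _ _ cP (leqnn e.+1).
    by split=> [|nP]; [apply: subset_trans Pn | apply: nPe;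
      apply: (subset_trans Pn)].
  by rewrite ie; apply/ltP/leqW.
have [iP0 _ P0prime] := cP.1 0%N isT.
(* If [x] were in [P 0], the unshifted chain would lie above [J + (x)] and be too long for the
   remaining generators. *)
have [P0x|nP0x] := pselect (P 0%N x).
  have [|eE _ _] := IH _ _ _ iJx nE cP _ (leqW lee); first exact: adjoin_min.
  by rewrite -eE ltnn in lee.
have [|Q [cQ P0Q Q0x _]] := chain_shift cP' (x := x); first by rewrite /P' ltnn.
rewrite /P' leq0n in P0Q.
have [|-> Q0E regxs] := IH _ _ _ iJx nE cQ _ lee.
  apply: adjoin_min => //; first by case: (cQ.1 0%N isT).
  exact: subset_trans P0Q.
(* [P 0] lies in [J + (x)] but misses [x], so by primality it lies in [J + x P 0]. *)
suff P0J : P 0%N `<=` J.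
  have P0E : P 0%N = J by apply/seteqP.
  by split=> //; split=> //; rewrite -P0E //; apply: cP.1.
apply: subset_trans (saturation_local iJ).
apply: (nakayama hR local_prime (principal_ideal x) iP0 iJ) =>
  [_ [t _ <-]|p Pp].
  exact: (idealZl _ inn).
apply: (sub_saturation local_prime).
have : Q 0%N p by apply: P0Q.
rewrite Q0E => -[j Jj [_ [t _ <-] E]]; exists j => //; exists (t * x) => //.
rewrite mulrC; apply: ideal_mulM; first by exists 1; rewrite ?mul1r.
have [//|] : P 0%N t \/ P 0%N x; last by [].
apply: P0prime; rewrite (_ : t * x = p - j); last by rewrite -E; ring.
by apply: (idealB iP0) => //; apply: JP.
Qed.

End RegularSequence.

(** * The ring A *)

Section Quotient.
Variables (A : comNzRingType) (x y z : A) (m : set A).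

Definition in_xy c := exists p q, c = p * x + q * y.

Hypotheses (im : is_ideal m)
  (mxyz : forall u, m u -> exists p q r, u = p * x + q * y + r * z)
  (mx : m x) (my : m y) (mz : m z).
Hypothesis munit : forall v, ~ m v -> exists w j, m j /\ 1 = w * v + j.
Hypotheses (x3 : x ^+ 3 = 0) (xy : x * y = 0) (yy : y ^+ 2 = x * z).
(** The filtration in terms of elements: [z] is a nonzerodivisor on [A / (x, y)], and [(x, y)]
    contains the annihilators of [y] modulo [(x)] and of [x] modulo [(x^2)]. *)
Hypotheses (xyz : forall c, in_xy (c * z) -> in_xy c)
  (xpy : forall c p, c * y = p * x -> in_xy c)
  (x2px : forall c p, c * x = p * x ^+ 2 -> in_xy c)
  (x2_neq0 : x ^+ 2 <> 0)
  (x_min : forall p q r, x <> p * y + q * z + r * x ^+ 2).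

Lemma x2z : x ^+ 2 * z = 0.
Proof. by rewrite expr2 -mulrA -yy expr2 mulrA xy mul0r. Qed.

Lemma y3 : y ^+ 3 = 0.
Proof. by rewrite exprSr yy -mulrA (mulrC z) mulrA xy mul0r. Qed.

Lemma x2m u : m u -> u * x ^+ 2 = 0.
Proof.
move=> /mxyz[p [q [r ->]]].
have -> : (p * x + q * y + r * z) * x ^+ 2 = p * x ^+ 3 + q * x * (x * y)
  + r * (x ^+ 2 * z) by ring.
by rewrite x3 xy x2z !mulr0 !addr0.
Qed.

Lemma xyzX n c : in_xy (c * z ^+ n) -> in_xy c.
Proof.
by elim: n c => [|n IH] c; rewrite ?mulr1 // exprS mulrA => /IH /xyz.
Qed.

(* The exponent is [n.+1]: this [n] is one less than in the theorem. *)
Variables (n : nat) (f g : A).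
Let a := z ^+ n.+1 + x * f + y * g.
(** [al] and [be] come from dividing by [z]: [a * x = al * z + f * x ^+ 2] and [a * y = be * z]. *)
Let al := x * z ^+ n.
Let be := y * z ^+ n + x * g.

Lemma mulax : a * x = x * z ^+ n.+1 + f * x ^+ 2.
Proof.
have -> : a * x = x * z ^+ n.+1 + f * x ^+ 2 + g * (x * y) by rewrite /a; ring.
by rewrite xy mulr0 addr0.
Qed.

Lemma mulay : a * y = be * z.
Proof.
have -> : a * y = y * z ^+ n.+1 + f * (x * y) + g * y ^+ 2 by rewrite /a; ring.
by rewrite xy yy /be (exprS z); ring.
Qed.

Lemma mulaxx : a * x ^+ 2 = 0.
Proof.
have -> : a * x ^+ 2 = z ^+ n * (x ^+ 2 * z) + f * x ^+ 3 + g * x * (x * y)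
  by rewrite /a (exprS z); ring.
by rewrite xy x3 x2z !mulr0 !addr0.
Qed.

(* [A / (x)] is an extension of [A / (x, y)] by [(x, y) / (x)], which is
   isomorphic to it, and a acts on both as [z ^+ n.+1], injectively. *)
Lemma mula_in_x c p : a * c = p * x -> exists e, c = e * x.
Proof.
move=> E; have [c1 [c2 Ec]] : in_xy c.
  apply: (@xyzX n.+1); exists (p - c * f), (- (c * g)).
  have -> : c * z ^+ n.+1 = a * c - c * f * x - c * g * y by rewrite /a; ring.
  by rewrite E; ring.
have [d1 [d2 Ed]] : in_xy c2.
  apply: (@xyzX n.+1); apply: (@xpy _ (p - c1 * z ^+ n.+1 - c1 * f * x
    - c2 * g * z)).
  have -> : c2 * z ^+ n.+1 * y = a * c - c1 * (a * x) - c2 * g * y ^+ 2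
    - c2 * f * (x * y).
    by rewrite Ec /a; ring.
  by rewrite E xy mulax yy; ring.
exists (c1 + d2 * z); rewrite Ec Ed.
have -> : c1 * x + (d1 * x + d2 * y) * y = c1 * x + d1 * (x * y) + d2 * y ^+ 2
  by ring.
by rewrite xy yy; ring.
Qed.

(** One layer further: [(x) / (x^2)] is again a copy of [A / (x, y)], on which [a] acts as
    [z ^+ n.+1]. *)
Lemma mula_in_x2 c p : a * c = p * x ^+ 2 -> exists e, c = e * x ^+ 2.
Proof.
move=> E; have [e Ee] : exists e, c = e * x.
  by apply: (@mula_in_x _ (p * x)); rewrite E; ring.
have [d1 [d2 Ed]] : in_xy e.
  apply: (@xyzX n.+1); apply: (@x2px _ (p - e * f)).
  have -> : e * z ^+ n.+1 * x = e * (x * z ^+ n.+1 + f * x ^+ 2)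
    - e * f * x ^+ 2 by ring.
  rewrite -mulax; have -> : e * (a * x) = a * c by rewrite Ee; ring.
  by rewrite E; ring.
exists d1; rewrite Ee Ed.
have -> : (d1 * x + d2 * y) * x = d1 * x ^+ 2 + d2 * (x * y) by ring.
by rewrite xy mulr0 addr0.
Qed.

(** [c] is itself a multiple of [x ^+ 2], which [a] annihilates. Hence [Q] meets [(x^2)] only in
    zero. *)
Lemma mula_x2_eq0 c p : a * c = p * x ^+ 2 -> p * x ^+ 2 = 0.
Proof.
move=> E; have [e Ee] := mula_in_x2 E; rewrite -E Ee.
by rewrite mulrCA mulaxx mulr0.
Qed.

Lemma x2_in_Q c p : a * c = p * x ^+ 2 -> m p.
Proof.
move=> /mula_x2_eq0 E; apply: contrapT => /munit[w [j [mj E1]]]; apply: x2_neq0.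
by rewrite -[LHS]mul1r E1 mulrDl (x2m mj) addr0 -mulrA E mulr0.
Qed.

(** * The colon ideal [I] and its powers *)

Local Notation Q := (ideal_gen [set a]).
Local Notation I := (ideal_colon Q m).

Lemma in_Q u : Q u <-> exists c, u = a * c.
Proof.
rewrite ideal_gen1E; split=> [[c _ <-]|[c ->]]; first by exists c.
by exists c.
Qed.

Lemma in_I c : I c <-> [/\ Q (c * x), Q (c * y) & Q (c * z)].
Proof.
have iQ : is_ideal Q := ideal_gen_ideal _.
split=> [h|[hx hy hz] u /mxyz[p [q [r ->]]]]; first by split; apply: h.
rewrite !mulrDr !(mulrCA c); apply: (idealD iQ); [apply: (idealD iQ)|];
  exact: (idealZl _ iQ).
Qed.

(* [c * z = a * w] and [c * x = a * u] force [w = e * z] modulo [(x, y)], so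
   that [c - a * e] lies in [(x, y)]; the remaining coefficients are then
   divisible by [z^n], up to multiples of [x^2]. *)
Lemma socle c : I c ->
  exists e w1 w2 p, c = a * e + w1 * al + w2 * be + p * x ^+ 2.
Proof.
move=> /in_I[/in_Q[u Eu] _ /in_Q[w Ew]].
have [e [c1 [c2 Ec]]] : exists e, in_xy (c - a * e).
  have [p [q Epq]] : in_xy (c - z ^+ n * w).
    apply: xyz; exists (f * w), (g * w).
    by rewrite mulrBl Ew /a (exprS z); ring.
  have Ecw : c = z ^+ n * w + p * x + q * y
    by rewrite -(subrK (z ^+ n * w) c) Epq; ring.
  have [e Ee] : exists e, u = e * x by apply: (@mula_in_x _ c).
  have [w1 [w2 Ew12]] : in_xy (w - e * z).
    apply: (@xyzX n); apply: (@x2px _ (e * f - p)).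
    have -> : (w - e * z) * z ^+ n * x = c * x - p * x ^+ 2 - q * (x * y)
      - e * (x * z ^+ n.+1 + f * x ^+ 2) + e * f * x ^+ 2.
      by rewrite Ecw (exprS z); ring.
    by rewrite -mulax Eu Ee xy; ring.
  exists e, (p + z ^+ n * w1 - e * f), (q + z ^+ n * w2 - e * g).
  have Ew' : w = e * z + w1 * x + w2 * y.
    by rewrite -(subrK (e * z) w) Ew12; ring.
  by rewrite Ecw Ew' /a (exprS z); ring.
have [w1 [w2 Ew12]] : in_xy (w - e * z).
  apply: (@xyzX n.+1); exists (c1 * z - (w - e * z) * f),
    (c2 * z - (w - e * z) * g).
  have -> : (w - e * z) * z ^+ n.+1
    = a * w - a * e * z - (w - e * z) * (x * f + y * g).
    by rewrite /a; ring.
  by rewrite -Ew -mulrBl Ec; ring.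
have E : (c1 * x + c2 * y) * z = a * (w1 * x + w2 * y).
  by rewrite -Ec -Ew12 mulrBl Ew; ring.
(* Reading [E] modulo [(x)] determines [c2] modulo [(x, y)]; after [y ^+ 2] is rewritten as [x * z],
   reading it modulo [(x^2)] determines [c1]. *)
have [q1 [q2 Eq]] : in_xy (c2 - w2 * z ^+ n).
  apply: xyz; apply: (@xpy _ (w1 * z ^+ n.+1 + w1 * f * x + w2 * g * z
    - c1 * z)).
  have -> : (c2 - w2 * z ^+ n) * z * y = (c1 * x + c2 * y) * z - c1 * z * x
    - w2 * y * z ^+ n.+1 by rewrite (exprS z); ring.
  by rewrite E mulrDr !(mulrCA a) mulax mulay /be (exprS z); ring.
have Ecy : c2 * y = w2 * (y * z ^+ n) + q2 * z * x.
  rewrite -(subrK (w2 * z ^+ n) c2) Eq.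
  have -> : (q1 * x + q2 * y + w2 * z ^+ n) * y = q1 * (x * y) + q2 * y ^+ 2
    + w2 * (y * z ^+ n) by ring.
  by rewrite xy yy; ring.
have [r1 [r2 Er]] : in_xy (c1 + q2 * z - w2 * g - w1 * z ^+ n).
  apply: xyz; apply: (@x2px _ (w1 * f)).
  have -> : (c1 + q2 * z - w2 * g - w1 * z ^+ n) * z * x
    = (c1 * x + (w2 * (y * z ^+ n) + q2 * z * x)) * z - w2 * (be * z)
      - w1 * (x * z ^+ n.+1 + f * x ^+ 2) + w1 * f * x ^+ 2.
    by rewrite /be (exprS z); ring.
  by rewrite -Ecy E -mulay -mulax; ring.
exists e, w1, w2, r1; rewrite -[c](subrK (a * e)) Ec Ecy.
have -> : c1 * x + (w2 * (y * z ^+ n) + q2 * z * x)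
  = (c1 + q2 * z - w2 * g - w1 * z ^+ n) * x + w1 * al + w2 * be.
  by rewrite /al /be; ring.
rewrite Er.
have -> : (r1 * x + r2 * y) * x = r1 * x ^+ 2 + r2 * (x * y) by ring.
by rewrite xy; ring.
Qed.

Lemma Q_a : Q a. Proof. exact: sub_ideal_gen. Qed.

Lemma sub_Q_I u : Q u -> I u.
Proof. by move=> Qu v _; exact: (idealZr v (ideal_gen_ideal _) Qu). Qed.

Lemma x2_I : I (x ^+ 2).
Proof.
by move=> u mu; rewrite mulrC x2m //; apply: (ideal0 (ideal_gen_ideal _)).
Qed.

(** Coefficients of elements of [I] are constrained below by multiplying by [x], [y] or [z] and
    reading off a multiple of [x ^+ 2] modulo [Q]. *)
Lemma x2_Q p : Q (p * x ^+ 2) -> m p.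
Proof. by move=> /in_Q[c /esym/x2_in_Q]. Qed.

Lemma ideal_I : is_ideal I.
Proof. exact/ideal_colon_ideal/ideal_gen_ideal. Qed.

Lemma exp2_min J : is_ideal J -> (forall u v, I u -> I v -> J (u * v)) ->
  ideal_exp I 2 `<=` J.
Proof.
by move=> iJ h; rewrite /ideal_exp /= (ideal_mulT ideal_I); apply: ideal_mul_min.
Qed.

Lemma exp2M u v : I u -> I v -> ideal_exp I 2 (u * v).
Proof.
by move=> Iu Iv; rewrite /ideal_exp /= (ideal_mulT ideal_I); apply: ideal_mulM.
Qed.

Lemma QI_exp2 : ideal_mul Q I `<=` ideal_exp I 2.
Proof.
apply: ideal_mul_min => [|u v /sub_Q_I Iu Iv];
  [exact: ideal_exp_ideal | exact: exp2M].
Qed.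

(* Modulo QI, the products of the parts [v] of [u = a * e + v] determine I^2. *)
Lemma exp2_eq_of_parts (V : A -> Prop) :
  (forall u, I u -> exists e v, V v /\ u = a * e + v) ->
  (forall v, V v -> I v) ->
  (forall v w, V v -> V w -> ideal_mul Q I (v * w)) ->
  ideal_exp I 2 = ideal_mul Q I.
Proof.
move=> dec VI VV; apply/seteqP; split; last exact: QI_exp2.
have Qa e : Q (a * e) by apply/in_Q; exists e.
have iQI : is_ideal (ideal_mul Q I) := ideal_mul_ideal _ _.
apply: exp2_min => // u1 u2 /dec[e1 [v1 [V1 ->]]] /dec[e2 [v2 [V2 ->]]].
rewrite mulrDl [v1 * _]mulrDr; apply: (idealD iQI).
  by apply: ideal_mulM => //;
    apply: (idealD ideal_I (sub_Q_I (Qa e2)) (VI _ V2)).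
apply: (idealD iQI); last exact: VV.
by rewrite mulrC; apply: ideal_mulM (VI _ V1).
Qed.

(** Here [I = Q + (x^2)]: multiplying by [y] and then by [z] pushes [w2] and then [w1] into [m],
    while [m be] and [m al] lie in [Q + (x^2)]. The square of [x ^+ 2] vanishes. *)
Lemma exp2_unit : ~ m f -> ideal_exp I 2 = ideal_mul Q I.
Proof.
move=> nf; have iQ : is_ideal Q := ideal_gen_ideal _.
have iQI : is_ideal (ideal_mul Q I) := ideal_mul_ideal _ _.
have mf p : m (p * f) -> m p.
  move=> mpf; have [w [j [mj E]]] := munit nf.
  rewrite -[p]mulr1 E mulrDr; apply: (idealD im); last exact: (idealZl _ im).
  by rewrite mulrCA; apply: (idealZl _ im).
have Qa e : Q (a * e) by apply/in_Q; exists e.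
apply: (@exp2_eq_of_parts (fun v => exists p, v = p * x ^+ 2)) =>
  [u Iu|v [p ->]|v w [p ->] [q ->]].
- have [e [w1 [w2 [p Eu]]]] := socle Iu.
  have /in_I[_ Quy Quz] := Iu.
  have mw2 : m w2.
    apply/mf/x2_Q.
    have -> : w2 * f * x ^+ 2 = a * (e * y + w2 * x) - u * y.
      rewrite Eu.
      have -> : (a * e + w1 * al + w2 * be + p * x ^+ 2) * y = a * (e * y)
        + w1 * z ^+ n * (x * y) + w2 * (y ^+ 2 * z ^+ n) + w2 * g * (x * y)
          + p * x * (x * y).
        by rewrite /al /be; ring.
      rewrite xy yy (_ : a * (e * y + w2 * x) = a * (e * y) + w2 * (a * x));
        last by ring.
      by rewrite mulax (exprS z); ring.
    exact: (idealB iQ (Qa _) Quy).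
  have w2be : exists p', w2 * be = a * p'.1 + p'.2 * x ^+ 2.
    have /mxyz[p1 [p2 [p3 ->]]] := mw2.
    (* From [be * x = g * x ^+ 2], [be * y = a * x - f * x ^+ 2] and [be * z = a * y]. *)
    exists (p2 * x + p3 * y, p1 * g - p2 * f).
    have -> : (p1 * x + p2 * y + p3 * z) * be = p1 * z ^+ n * (x * y)
      + p1 * g * x ^+ 2 + p2 * z ^+ n * y ^+ 2 + p2 * g * (x * y)
        + p3 * (be * z).
      by rewrite /be; ring.
    rewrite -mulay xy yy /=.
    have -> : a * (p2 * x + p3 * y) = p2 * (a * x) + p3 * (a * y) by ring.
    by rewrite mulax (exprS z); ring.
  have [[e2 p2] /= Ew2] := w2be.
  have mw1 : m w1.
    apply/mf/x2_Q.
    have -> : w1 * f * x ^+ 2 = a * (w1 * x + e * z + e2 * z) - u * z.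
      rewrite Eu Ew2.
      have -> : (a * e + w1 * al + (a * e2 + p2 * x ^+ 2) + p * x ^+ 2) * z
        = a * (e * z) + w1 * (al * z) + a * (e2 * z) + (p2 + p) * (x ^+ 2 * z)
          by ring.
      rewrite x2z (_ : a * (w1 * x + e * z + e2 * z) = a * (e * z)
        + a * (e2 * z) + w1 * (a * x)); last by ring.
      by rewrite mulax /al (exprS z); ring.
    exact: (idealB iQ (Qa _) Quz).
  have [p1 [q1 [r1 Ew1]]] := mxyz mw1.
  exists (e + r1 * x + e2), (r1 * - f * x ^+ 2 + p1 * z ^+ n * x ^+ 2
    + p2 * x ^+ 2 + p * x ^+ 2).
  split; first by exists (r1 * - f + p1 * z ^+ n + p2 + p); ring.
  rewrite Eu Ew2 Ew1.
  have -> : (p1 * x + q1 * y + r1 * z) * al = p1 * z ^+ n * x ^+ 2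
    + q1 * z ^+ n * (x * y) + r1 * (x * z ^+ n.+1).
    by rewrite /al (exprS z); ring.
  have -> : x * z ^+ n.+1 = a * x - f * x ^+ 2 by rewrite mulax; ring.
  by rewrite xy; ring.
- by apply: (idealZl _ ideal_I); apply: x2_I.
- have -> : p * x ^+ 2 * (q * x ^+ 2) = p * q * x * x ^+ 3 by ring.
  by rewrite x3 mulr0; apply: ideal0.
Qed.

(** Now [f * x ^+ 2 = 0], and [0 < n] makes [x] and [y] kill [al], which thus lies in [I]. Only
    [be ^+ 2] can survive among the products; its part [z ^+ n * (be * y)] equals [a * al]. *)
Lemma exp2_maximal : m f -> (0 < n)%N -> ideal_exp I 2 = ideal_mul Q I.
Proof.
move=> mf; case En: n => [//|k] _.
have iQ : is_ideal Q := ideal_gen_ideal _.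
have iQI : is_ideal (ideal_mul Q I) := ideal_mul_ideal _ _.
have fx2 : f * x ^+ 2 = 0 by apply: x2m.
have ax : a * x = al * z by rewrite mulax fx2 /al (exprS z); ring.
have alx : al * x = 0.
  have -> : al * x = z ^+ k * (x ^+ 2 * z) by rewrite /al En (exprS z); ring.
  by rewrite x2z mulr0.
have aly : al * y = 0.
  have -> : al * y = z ^+ n * (x * y) by rewrite /al; ring.
  by rewrite xy mulr0.
have bex : be * x = g * x ^+ 2.
  have -> : be * x = z ^+ n * (x * y) + g * x ^+ 2 by rewrite /be; ring.
  by rewrite xy mulr0 add0r.
have bexx : be * x * x = 0 by rewrite bex -mulrA -exprSr x3 mulr0.
have bey : be * y = a * x.
  have -> : be * y = z ^+ n * y ^+ 2 + g * (x * y) by rewrite /be; ring.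
  by rewrite xy yy ax /al; ring.
have Qa e : Q (a * e) by apply/in_Q; exists e.
have Ial : I al.
  by apply/in_I; rewrite alx aly -ax; split; [apply: ideal0..|].
(* The condition [m (w2 * g)] expresses that [w2 * be] is in [I], since [be * x = g * x ^+ 2]; it
   also kills the other part of [be ^+ 2]. *)
apply: (@exp2_eq_of_parts (fun v => exists w1 w2 p, v = w1 * al + w2 * be
  + p * x ^+ 2 /\ m (w2 * g))).
- move=> u Iu; have [e [w1 [w2 [p Eu]]]] := socle Iu.
  exists e, (w1 * al + w2 * be + p * x ^+ 2); split; last by rewrite Eu; ring.
  exists w1, w2, p; split=> //.
  have /in_I[Qux _ _] := Iu; apply: x2_Q.
  have -> : w2 * g * x ^+ 2 = u * x - a * (e * x).
    rewrite Eu.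
    have -> : (a * e + w1 * al + w2 * be + p * x ^+ 2) * x = a * (e * x)
      + w1 * (al * x) + w2 * (be * x) + p * x ^+ 3 by ring.
    by rewrite alx bex x3; ring.
  exact: (idealB iQ Qux (Qa _)).
- move=> v [w1 [w2 [p [-> mw2]]]].
  apply: (idealD ideal_I); last by apply: (idealZl _ ideal_I); apply: x2_I.
  apply: (idealD ideal_I); first exact: (idealZl _ ideal_I).
  apply/in_I; split.
  + by rewrite -mulrA bex mulrA x2m //; apply: ideal0.
  + by rewrite -mulrA bey mulrCA.
  + by rewrite -mulrA -mulay mulrCA.
- move=> v v' [w1 [w2 [p [-> mw2]]]] [w1' [w2' [p' [-> mw2']]]].
  have -> : (w1 * al + w2 * be + p * x ^+ 2) * (w1' * al + w2' * be
    + p' * x ^+ 2)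
    = w2 * w2' * (z ^+ n * (be * y)) + w2' * (w2 * g) * (be * x)
      + (al * x) * (w1 * w1' * z ^+ n + w1 * p' * x + w1' * p * x + (w1 * w2'
        + w2 * w1') * g) + (al * y) * (z ^+ n * (w1 * w2' + w2 * w1'))
      + (be * x) * x * (w2 * p' + w2' * p) + p * p' * x * x ^+ 3.
    by rewrite /al /be; ring.
  rewrite alx aly bexx bex x3 bey -!mulrA.
  have -> : w2 * (w2' * (z ^+ n * (a * x))) = a * (w2 * w2' * al)
    by rewrite /al; ring.
  have -> : w2' * (w2 * (g * (g * x ^+ 2))) = w2' * (g * (w2 * g * x ^+ 2))
    by ring.
  rewrite x2m // !(mul0r, mulr0, addr0).
  exact: (ideal_mulM Q_a (idealZl _ ideal_I Ial)).
Qed.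

Lemma y2_regular : m f -> n = 0%N -> y ^+ 2 = a * x.
Proof. by move=> mf En; rewrite mulax x2m // yy En; ring. Qed.

Lemma y_I : m f -> n = 0%N -> I y.
Proof.
move=> mf En; have Ey := y2_regular mf En; apply/in_I; split.
- by rewrite mulrC xy; apply: (ideal0 (ideal_gen_ideal _)).
- by rewrite -expr2 Ey; apply/in_Q; exists x.
have -> : y * z = a * y - g * (y ^+ 2) - f * (x * y) by rewrite /a En; ring.
by rewrite xy Ey; apply/in_Q; exists (y - g * x); ring.
Qed.

(** Now [al = x] and [be = y + x * g]. The total coefficient [w1 + w2 * g] of [x] lies in [m], and
    [m x] lies in [Q + (x^2)] because [x * z = a * x]. *)
Lemma socle_regular u : m f -> n = 0%N -> I u ->
  exists e s t, u = a * e + s * y + t * x ^+ 2.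
Proof.
move=> mf En Iu; have iQ : is_ideal Q := ideal_gen_ideal _.
have [e [w1 [w2 [p Eu]]]] := socle Iu.
have xz : x * z = a * x by rewrite -yy y2_regular.
have [p1 [q1 [r1 Ew]]] : exists p1 q1 r1, w1 + w2 * g = p1 * x + q1 * y
  + r1 * z.
  apply: mxyz; have /in_I[Qux _ _] := Iu; apply: x2_Q.
  have -> : (w1 + w2 * g) * x ^+ 2 = u * x - a * (e * x).
    rewrite Eu /al /be En expr0.
    have -> : (a * e + w1 * (x * 1) + w2 * (y * 1 + x * g) + p * x ^+ 2) * x
      = a * (e * x) + (w1 + w2 * g) * x ^+ 2 + w2 * (x * y) + p * x ^+ 3
        by ring.
    by rewrite xy x3; ring.
  by apply: (idealB iQ) => //; apply/in_Q; exists (e * x).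
exists (e + r1 * x), w2, (p + p1).
have -> : u = a * e + (w1 + w2 * g) * x + w2 * y + p * x ^+ 2.
  by rewrite Eu /al /be En; ring.
rewrite Ew; have -> : (p1 * x + q1 * y + r1 * z) * x = p1 * x ^+ 2
  + q1 * (x * y) + r1 * (x * z) by ring.
by rewrite xy xz; ring.
Qed.

(** [y ^+ 2 = a * x] is in [I^2]. Were it in [a I], cancelling [a] up to [(x^2)] would put [x] in
    [I], hence in [(y, z, x^2)] as [f] is in [m]. *)
Lemma exp2_neq : m f -> n = 0%N -> ideal_exp I 2 <> ideal_mul Q I.
Proof.
move=> mf En EI; have Iy := y_I mf En.
have : ideal_mul Q I (a * x).
  by rewrite -EI -(y2_regular mf En) expr2; apply: exp2M.
rewrite (ideal_mul1E _ ideal_I) => -[c Ic Ec].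
have [e [s [t Eu]]] := socle_regular mf En Ic.
have [d Ed] : exists d, x - c = d * x ^+ 2.
  by apply: (@mula_in_x2 _ 0); rewrite mulrBr Ec; ring.
have [p [q [r Ef]]] := mxyz mf.
apply: (@x_min (e * g + s) (e + e * r * x) (d + t + e * p)).
have {1}-> : x = e * z + (e * g + s) * y + (d + t) * x ^+ 2 + e * f * x.
  by rewrite -[LHS](subrK c) Ed Eu /a En; ring.
rewrite Ef.
have -> : e * (p * x + q * y + r * z) * x
  = e * p * x ^+ 2 + e * q * (x * y) + e * r * x * z by ring.
by rewrite xy; ring.
Qed.

(** [x ^+ 2] kills [I^2], so modulo [Q I^2] only [y I^2] matters. Expanding both factors of a
    product in [I^2] leaves multiples of [a], since [y ^+ 3 = 0]. *)
Lemma exp3_regular : m f -> n = 0%N ->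
  ideal_exp I 3 = ideal_mul Q (ideal_exp I 2).
Proof.
move=> mf En; have iI2 := ideal_exp_ideal I 2.
have iQI2 : is_ideal (ideal_mul Q (ideal_exp I 2)) := ideal_mul_ideal _ _.
have Iy := y_I mf En.
have Qa c : ideal_exp I 2 c -> ideal_mul Q (ideal_exp I 2) (a * c).
  exact: (ideal_mulM Q_a).
have ma : m a.
  by rewrite /a exprSr; apply: (idealD im); [apply: (idealD im)|];
    [apply: (idealZl _ im) | apply: (idealZr _ im) | apply: (idealZr _ im)].
have mI u : I u -> m u.
  move=> /(socle_regular mf En)[e [s [t ->]]]; apply: (idealD im).
    by apply: (idealD im); [apply: (idealZr _ im) | apply: (idealZl _ im)].
  by rewrite expr2; do 2!apply: (idealZl _ im).
have mI2 v : ideal_exp I 2 v -> m v.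
  by move: v; apply: exp2_min => // u v /mI mu _; apply: (idealZr _ im).
apply/seteqP; split; last first.
  apply: ideal_mul_min => [|u v /sub_Q_I Iu Iv]; first exact: ideal_exp_ideal.
  exact: ideal_mulM.
apply: ideal_mul_min => // u v Iu I2v.
have [e [s [t ->]]] := socle_regular mf En Iu.
have -> : (a * e + s * y + t * x ^+ 2) * v = a * (e * v) + s * (y * v)
  + t * (v * x ^+ 2) by ring.
rewrite (x2m (mI2 _ I2v)) mulr0 addr0; apply: (idealD iQI2).
  by apply: Qa; apply: (idealZl _ iI2).
apply: (idealZl _ iQI2) => {e s t}.
move: v I2v;
  suff : ideal_exp I 2 `<=` ideal_colon (ideal_mul Q (ideal_exp I 2)) [set y].
  by move=> h v /h/(_ y erefl); rewrite mulrC.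
apply: exp2_min; first exact: ideal_colon_ideal.
move=> u1 u2 Iu1 Iu2 _ ->.
have [e1 [s1 [t1 ->]]] := socle_regular mf En Iu1.
have [e2 [s2 [t2 Eu2]]] := socle_regular mf En Iu2.
have -> : (a * e1 + s1 * y + t1 * x ^+ 2) * u2 * y = a * (e1 * (y * u2))
  + s1 * (y ^+ 2 * u2) + t1 * u2 * x * (x * y) by ring.
have -> : y ^+ 2 * u2 = a * (e2 * y ^+ 2) + s2 * y ^+ 3 + t2 * x * y * (x * y)
  by rewrite Eu2; ring.
rewrite xy y3 !mulr0 !addr0 [s1 * _]mulrCA -mulrDr; apply: Qa.
exact: (idealD iI2 (idealZl _ iI2 (exp2M Iy Iu2))
  (idealZl _ iI2 (idealZl _ iI2 (exp2M Iy Iy)))).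
Qed.

End Quotient.

(** * Descent from R to A *)

(** Derives an equation from a known one, with the factor [k] as a certificate that [ring]
    checks. *)
Lemma eq_of_multiple (R : comNzRingType) (k u v l r : R) :
  u = v -> l - r = k * (u - v) -> l = r.
Proof. by move=> ->; rewrite subrr mulr0 => /eqP; rewrite subr_eq0 => /eqP. Qed.

Section RegularTriple.
Variables (R : comNzRingType) (nn : set R) (X Y Z : R).
Hypotheses (inn : is_ideal nn) (nn1 : ~ nn 1) (nX : nn X) (nY : nn Y) (nZ : nn
  Z).
Hypotheses (regX : forall c, c * X = 0 -> c = 0)
  (regY : forall c p, c * Y = p * X -> exists q, c = q * X)
  (regZ : forall c, in_xy X Y (c * Z) -> in_xy X Y c).

Definition in_aa u :=
  exists p q r, u = p * X ^+ 3 + q * (X * Y) + r * (Y ^+ 2 - X * Z).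

(** The relation is resolved modulo [(X, Y)], then modulo [(X)]; cancelling [X] leaves [1] in
    [nn]. *)
Lemma regular_X_minimal p q r : X <> p * Y + q * Z + r * X ^+ 2.
Proof.
move=> E; have [q1 [q2 Eq]] : in_xy X Y q.
  apply: regZ; exists (1 - r * X), (- p).
  by apply: (eq_of_multiple (k := -1) E); ring.
have [t Et] : exists t, p + q2 * Z = t * X.
  apply: (@regY _ (1 - r * X - q1 * Z)); rewrite Eq in E.
  by apply: (eq_of_multiple (k := -1) E); ring.
have E1 : 1 - (r * X + q1 * Z + t * Y) = 0.
  apply: regX; have Ep : p = t * X - q2 * Z by rewrite -Et; ring.
  by rewrite Eq Ep in E; apply: (eq_of_multiple (k := 1) E); ring.
apply: nn1; have -> : 1 = r * X + q1 * Z + t * Y by apply/eqP;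
  rewrite -subr_eq0 E1.
by apply: (idealD inn); [apply: (idealD inn)|]; apply: (idealZl _ inn).
Qed.

Lemma regular_Z c p q : in_aa (c * Z - (p * X + q * Y)) -> in_xy X Y c.
Proof.
move=> [p' [q' [r' E]]]; apply: regZ.
exists (p + p' * X ^+ 2 - r' * Z), (q + q' * X + r' * Y).
by apply: (eq_of_multiple (k := 1) E); ring.
Qed.

Lemma regular_Y c p : in_aa (c * Y - p * X) -> in_xy X Y c.
Proof.
move=> [p' [q' [r' E]]].
have [t Et] : exists t, c - r' * Y = t * X.
  apply: (@regY _ (p + p' * X ^+ 2 + q' * Y - r' * Z)).
  by apply: (eq_of_multiple (k := 1) E); ring.
by exists t, r'; rewrite -Et; ring.
Qed.

Lemma regular_X c p : in_aa (c * X - p * X ^+ 2) -> in_xy X Y c.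
Proof.
move=> [p' [q' [r' E]]].
(* Modulo [X] only [r' * Y ^+ 2] survives, so [Y] cancels twice and [r'] is a multiple of [X]. *)
have [t Et] : exists t, r' * Y = t * X.
  apply: (@regY _ (c - p * X - p' * X ^+ 2 - q' * Y + r' * Z)).
  by apply: (eq_of_multiple (k := -1) E); ring.
have [s Es] := regY Et; exists (p + p' * X - s * Z), (q' + s * Y).
apply/eqP; rewrite -subr_eq0; apply/eqP/regX.
by rewrite Es in E; apply: (eq_of_multiple (k := 1) E); ring.
Qed.

(** Dividing such a relation by [X] would put [X] in [(Y, Z, X^2)]. *)
Lemma regular_X2 : ~ in_aa (X ^+ 2).
Proof.
move=> [p [q [r E]]].
have [t Et] : exists t, r * Y = t * X.
  apply: (@regY _ (X - p * X ^+ 2 - q * Y + r * Z)).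
  by apply: (eq_of_multiple (k := -1) E); ring.
have [s Es] := regY Et.
apply: (@regular_X_minimal (q + s * Y) (- s * X) p).
apply/eqP; rewrite -subr_eq0; apply/eqP/regX.
by rewrite Es in E; apply: (eq_of_multiple (k := 1) E); ring.
Qed.

End RegularTriple.

Lemma adjoin0E (R : comNzRingType) (X c : R) :
  adjoin [set 0] X c <-> exists q, c = q * X.
Proof.
split=> [[_ -> [_ [q _ <-] <-]]|[q ->]]; first by exists q; rewrite add0r.
by exists 0 => //; exists (q * X); [exists q | rewrite add0r].
Qed.

Lemma adjoin_in_xy (R : comNzRingType) (X Y c : R) :
  adjoin (adjoin [set 0] X) Y c <-> in_xy X Y c.
Proof.
split=> [[_ /adjoin0E[p ->] [_ [q _ <-] <-]]|[p [q ->]]]; first by exists p, q.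
exists (p * X); first by apply/adjoin0E; exists p.
by exists (q * Y) => //; exists q.
Qed.

Lemma regular_local_prime_sequence (R : comNzRingType) (nn : set R) (X Y Z : R)
  :
  regular_local_ring nn 3 -> nn = ideal_gen [set` [:: X; Y; Z]] ->
  prime_sequence [set 0] [:: X; Y; Z].
Proof.
move=> [hR hloc [[P cP] _] _] hnn.
have [iP0 _ _] := cP.1 0%N isT.
rewrite ideal_gen_seqE in hnn.
have [||_ _ //] := prime_sequence_of_chain hR hloc (is_ideal0 R) hnn cP => //.
by move=> _ ->; apply: ideal0.
Qed.

Theorem mainTheorem13
    (R : comNzRingType) (nn : set R) (X Y Z : R)
    (hR : regular_local_ring nn 3)
    (hnn : nn = ideal_gen [set` [:: X; Y; Z]])
    (aa : idealr R)
    (haa : [set` aa] = ideal_gen [set` [:: X ^+ 3; X * Y; Y ^+ 2 - X * Z]])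
    (m : set {ideal_quot aa}) (hm : maximal_ideal m)
    (n : nat) (hn : (1 <= n)%N)
    (f g : {ideal_quot aa}) :
  let x := \pi_({ideal_quot aa}) X in
  let y := \pi_({ideal_quot aa}) Y in
  let z := \pi_({ideal_quot aa}) Z in
  let a := z ^+ n + x * f + y * g in
  let Q := ideal_gen [set a] in
  let I := ideal_colon Q m in
  (ideal_exp I 2 = ideal_mul Q I <-> ~ m f \/ (m f /\ (1 < n)%N)) /\
  (m f -> n = 1%N ->
     ideal_exp I 3 = ideal_mul Q (ideal_exp I 2) /\
     ideal_exp I 2 <> ideal_mul Q I).
Proof.
have [pr0 X0 [prX YX [prXY ZXY _]]] := regular_local_prime_sequence hR hnn.
have [hN hloc _ _] := hR.
have inn := local_ideal hloc; have nn1 := local_proper hloc.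
rewrite ideal_gen_seqE in hnn.
have nnE u : nn u <-> exists p q r, u = p * X + q * Y + r * Z.
  rewrite hnn;
    split=> [[_ /adjoin_in_xy[p [q ->]] [_ [r _ <-] <-]]|[p [q [r ->]]]].
    by exists p, q, r.
  exists (p * X + q * Y); first by apply/adjoin_in_xy; exists p, q.
  by exists (r * Z) => //; exists r.
have nX : nn X by apply/nnE; exists 1, 0, 0; ring.
have nY : nn Y by apply/nnE; exists 0, 1, 0; ring.
have nZ : nn Z by apply/nnE; exists 0, 0, 1; ring.
have regX c : c * X = 0 -> c = 0 by move=> cX; have [_ _ /(_ c X cX)[]] := pr0.
have regY c p : c * Y = p * X -> exists q, c = q * X.
  move=> cY; apply/adjoin0E; have [_ _ /(_ c Y)[]//] := prX.
  by apply/adjoin0E; exists p.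
have regZ c : in_xy X Y (c * Z) -> in_xy X Y c.
  by move=> /adjoin_in_xy cZ; apply/adjoin_in_xy;
    have [_ _ /(_ c Z cZ)[]] := prXY.
have aaE u : u \in aa <-> in_aa X Y Z u.
  have -> : u \in aa <-> [set` aa] u by [].
  rewrite haa ideal_gen_seqE; split.
    move=> [_ [_ [_ -> [_ [p _ <-] <-]] [_ [q _ <-] <-]] [_ [r _ <-] <-]].
    by exists p, q, r; rewrite add0r.
  move=> [p [q [r ->]]]; exists (p * X ^+ 3 + q * (X * Y)); last first.
    by exists (r * (Y ^+ 2 - X * Z)) => //; exists r.
  exists (p * X ^+ 3); last by exists (q * (X * Y)) => //; exists q.
  by apply/adjoin0E; exists p.
have aan u : u \in aa -> nn u.
  move=> /aaE[p [q [r ->]]]; apply/nnE.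
  by exists (p * X ^+ 2), (q * X + r * Y), (- r * X); ring.
pose A := {ideal_quot aa}; pose pi u : A := \pi_A u.
have piD u v : pi (u + v) = pi u + pi v by rewrite /pi rmorphD.
have piM u v : pi (u * v) = pi u * pi v by rewrite /pi rmorphM.
have piX u k : pi (u ^+ k) = pi u ^+ k by rewrite /pi rmorphXn.
have pi1 : pi 1 = 1 by rewrite /pi rmorph1.
have pi0 : pi 0 = 0 by rewrite /pi rmorph0.
have piS (c : A) : exists u, c = pi u by exists (repr c); rewrite /pi reprK.
have piP u v : pi u = pi v <-> in_aa X Y Z (u - v).
  by rewrite -aaE Quotient.idealrBE; split=> /eqP.
(* The image of [nn] is a proper ideal, and everything outside it is a unit, so a maximal ideal must
   equal it. *)
have mE : m = [set pi u | u in nn].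
  pose m' := [set pi u | u in nn].
  have im' : is_ideal m'.
    split; first by exists 0; rewrite ?pi0 //; apply: ideal0.
      by move=> _ _ [u nu <-] [v nv <-]; exists (u + v); rewrite ?piD //;
        apply: idealD.
    move=> c _ [u nu <-]; have [w ->] := piS c.
    by exists (w * u); rewrite ?piM //; apply: (idealZl _ inn).
  have m'1 : ~ m' 1.
    move=> [u nu]; rewrite -pi1 => /piP/aaE/aan nu1; apply: nn1.
    by rewrite (_ : 1 = u - (u - 1)); [apply: (idealB inn) | ring].
  have [im mT maxm] := hm.
  have [|mm'] := pselect (m `<=` m').
    by move=> /(maxm _ im')[//|m'T]; case: m'1; rewrite m'T.
  have [c /not_implyP[mc nm'c]] : exists c, ~ (m c -> m' c).
    by apply/existsNP => h; apply: mm' => c; apply: h.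
  have [u Eu] := piS c.
  have /(local_unit hN hloc)[t tu] : ~ nn u by move=> nu; apply: nm'c; exists u.
  have /(ideal_properP im) [] := mT.
  by rewrite -pi1 -tu piM -Eu; apply: (idealZl _ im).
have [im _ _] := hm; clear hm.
have mxyz c : m c -> exists p q r, c = p * pi X + q * pi Y + r * pi Z.
  rewrite mE => -[u /nnE[p [q [r ->]]] <-].
  by exists (pi p), (pi q), (pi r); rewrite !piD !piM.
have mx : m (pi X) by rewrite mE; exists X.
have my : m (pi Y) by rewrite mE; exists Y.
have mz : m (pi Z) by rewrite mE; exists Z.
have munit v : ~ m v -> exists w j, m j /\ 1 = w * v + j.
  have [u ->] := piS v; rewrite mE => nu.
  have /(local_unit hN hloc)[t tu] : ~ nn u by move=> nnu; apply: nu; exists u.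
  exists (pi t), 0; split; last by rewrite addr0 -piM tu pi1.
  by exists 0 => //; apply: ideal0.
have x3 : pi X ^+ 3 = 0.
  by rewrite -piX -pi0; apply/piP; exists 1, 0, 0; ring.
have xy : pi X * pi Y = 0.
  by rewrite -piM -pi0; apply/piP; exists 0, 1, 0; ring.
have yy : pi Y ^+ 2 = pi X * pi Z.
  by rewrite -piX -piM; apply/piP; exists 0, 0, 1; ring.
have pixy u : in_xy X Y u -> in_xy (pi X) (pi Y) (pi u).
  by move=> [p [q ->]]; exists (pi p), (pi q); rewrite piD !piM.
have xyz c : in_xy (pi X) (pi Y) (c * pi Z) -> in_xy (pi X) (pi Y) c.
  have [u ->] := piS c; move=> [p [q]].
  have [[p' ->] [q' ->]] := (piS p, piS q).
  by rewrite -!piM -piD => /piP/(regular_Z regZ)/pixy.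
have xpy c p : c * pi Y = p * pi X -> in_xy (pi X) (pi Y) c.
  have [[u ->] [p' ->]] := (piS c, piS p).
  by rewrite -!piM => /piP/(regular_Y regY)/pixy.
have x2px c p : c * pi X = p * pi X ^+ 2 -> in_xy (pi X) (pi Y) c.
  have [[u ->] [p' ->]] := (piS c, piS p).
  by rewrite -piX -!piM => /piP/(regular_X regX regY)/pixy.
have x2_neq0 : pi X ^+ 2 <> 0.
  rewrite -piX -pi0 => /piP; rewrite subr0.
  exact: (regular_X2 inn nn1 nX nY nZ regX regY regZ).
have x_min p q r : pi X <> p * pi Y + q * pi Z + r * pi X ^+ 2.
  have [[p1 ->] [q1 ->] [r1 ->]] := And3 (piS p) (piS q) (piS r).
  rewrite -piX -!piM -!piD => /piP[p2 [q2 [r2 E]]].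
  (* The generators of [aa] lie in [(Y, Z, X^2)] and are absorbed into the coefficients. *)
  apply: (@regular_X_minimal _ nn X Y Z inn nn1 nX nY nZ regX regY regZ
    (p1 + q2 * X + r2 * Y) (q1 - r2 * X) (r1 + p2 * X)).
  by apply: (eq_of_multiple (k := 1) E); ring.
(* From here on [n] is the predecessor of the exponent, so the exceptional case is [n = 0]. *)
case: n hn => // n _ x y z a Q I.
have unitE : ~ m f -> ideal_exp I 2 = ideal_mul Q I.
  exact: (exp2_unit im mxyz mx my mz munit x3 xy yy xyz xpy x2px x2_neq0).
have maxE : m f -> (0 < n)%N -> ideal_exp I 2 = ideal_mul Q I.
  exact: (exp2_maximal mxyz mx my mz munit x3 xy yy xyz xpy x2px x2_neq0).
have neqE : m f -> n = 0%N -> ideal_exp I 2 <> ideal_mul Q I.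
  exact: (exp2_neq mxyz mx my mz munit x3 xy yy xyz xpy x2px x2_neq0 x_min).
split; last first.
  move=> mf [n0]; split; last exact: neqE.
  exact: (exp3_regular im mxyz mx my mz munit x3 xy yy xyz xpy x2px x2_neq0).
split=> [E|[|[]]//]; have [mf|] := pselect (m f); [right|by left].
by split=> //; rewrite ltnS lt0n; apply/eqP => n0; apply: (neqE mf n0).
Qed.
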